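(* For any $\epsilon>0$, any integer $t\ge 2$, and all sufficiently large integers $n$, there exists a $(\pi/t-\epsilon)$AC graph with $n$ vertices and at least $3tn-O(tn^{2/3}/\epsilon)$ edges, where the $O(\cdot)$ hides an absolute constant.
   Context: A geometric graph is a graph whose vertices are distinct points in $\mathbb{R}^2$ and whose edges are straight-line segments joining their endpoints. Two edges cross if the segments intersect at a point other than a common endpoint; the crossing angle is the smaller angle between the two segments. For $\beta>0$, a geometric graph is a $\beta$ angle crossing ($\beta$AC) graph if every pair of crossing edges crosses at an angle of at least $\beta$. *)

(* Defs.v *)
From HB Require Import structures.
From mathcomp Require Import all_boot all_order all_algebra.
From mathcomp Require Import boolp classical_sets reals exp trigo.

Set Implicit Arguments.
Unset Strict Implicit.
Unset Printing Implicit Defensive.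

Import Order.TTheory GRing.Theory Num.Theory.

Local Open Scope ring_scope.

Section Plane.
Variable R : realType.
Implicit Types p q a b x u v : 'rV[R]_2.

Definition dot u v : R := \sum_(i < 2) u 0 i * v 0 i.

(* The library norm on matrices is the max norm, hence this definition. *)
Definition enorm u : R := Num.sqrt (dot u u).

Definition segment p q : set 'rV[R]_2 :=
  [set x | exists2 s : R, 0 <= s <= 1 & x = (1 - s) *: p + s *: q]%classic.

(* Any common point other than a common endpoint counts, so two segments also
   cross when an endpoint of one is interior to the other, or when they are
   collinear and overlap. *)
Definition segments_cross p q a b : Prop :=
  exists x, [/\ segment p q x, segment a b x &
    ~ ((x = p \/ x = q) /\ (x = a \/ x = b))].

Definition vec_angle u v : R := acos (dot u v / (enorm u * enorm v)).

Definition crossing_angle p q a b : R :=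
  let theta := vec_angle (q - p) (b - a) in Num.min theta (pi - theta).

End Plane.

Record geometric_graph (R : realType) (n : nat) := GeometricGraph {
  vpos : 'I_n -> 'rV[R]_2;
  vpos_inj : injective vpos;
  edges : {set {set 'I_n}};
  card_edge : forall e, e \in edges -> #|e| = 2%N
}.

Definition angle_crossing (R : realType) (beta : R) (n : nat)
    (G : geometric_graph R n) : Prop :=
  forall u v w z : 'I_n,
    [set u; v]%SET \in edges G -> [set w; z]%SET \in edges G ->
    [set u; v]%SET <> [set w; z]%SET ->
    segments_cross (vpos G u) (vpos G v) (vpos G w) (vpos G z) ->
    beta <= crossing_angle (vpos G u) (vpos G v) (vpos G w) (vpos G z).

(* Main.v *)
(** Take the vertices in an L x L integer grid, with L = floor (sqrt n).  Three
    integer vectors with pairwise determinants 1 or -1 span a unimodular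
    triangulation of the lattice, which is planar and has about 3n edges in the
    grid; applying SL_2(Z) to it makes all three vectors as close as desired to
    any prescribed direction.  Superimpose t such triangulations whose
    directions are within eps/2 of t lines at mutual angles at least pi/t:
    edges of different triangulations cross at an angle of at least
    pi/t - eps.  The vectors depend on t and eps only, so the boundary loses
    O(sqrt n) edges, which is o(n^(2/3)). *)
Require Import Defs.
From HB Require Import structures.
From mathcomp Require Import all_boot all_order all_algebra.
From mathcomp Require Import zify ring lra.
From mathcomp Require Import boolp classical_sets reals topology normedtype exp trigo.

Set Implicit Arguments.
Unset Strict Implicit.
Unset Printing Implicit Defensive.

Import Order.TTheory GRing.Theory Num.Theory.
Import numFieldNormedType.Exports.

Local Open Scope ring_scope.

(** * Lattice points and crossings of lattice segments *)

Section LatticeSegments.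
Variable R : realType.
Implicit Types p q a b d e f : (int * int)%type.

Definition vec2 (x y : R) : 'rV[R]_2 := \row_j (if j == 0 then x else y).

Definition latpt p : 'rV[R]_2 := vec2 p.1%:~R p.2%:~R.

Definition cross2 d e : int := d.1 * e.2 - d.2 * e.1.

Lemma vec2_inj x y x' y' : vec2 x y = vec2 x' y' -> x = x' /\ y = y'.
Proof.
move=> /rowP E; have:= E 0; have := E (lift ord0 ord0).
by rewrite !mxE.
Qed.

Lemma vec2D x y x' y' : vec2 x y + vec2 x' y' = vec2 (x + x') (y + y').
Proof. by apply/rowP => j; rewrite !mxE; case: ifP. Qed.

Lemma vec2Z c x y : c *: vec2 x y = vec2 (c * x) (c * y).
Proof. by apply/rowP => j; rewrite !mxE; case: ifP. Qed.

Lemma dot_vec2 x y x' y' : dot (vec2 x y) (vec2 x' y') = x * x' + y * y'.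
Proof. by rewrite /dot big_ord_recl big_ord1 !mxE. Qed.

Lemma latptB p q : latpt q - latpt p = latpt (q - p).
Proof. by apply/rowP => j; rewrite !mxE; case: ifP => _ /=; rewrite rmorphB. Qed.

Lemma latpt_inj : injective latpt.
Proof.
move=> [p1 p2] [q1 q2] /vec2_inj /= [/eqP + /eqP].
by rewrite !eqr_int => /eqP -> /eqP ->.
Qed.

Lemma int_unit_interval (s : R) (k : int) :
  0 <= s <= 1 -> s = k%:~R -> s = 0 \/ s = 1.
Proof.
move=> + sk; rewrite sk ler0z -[1]/(1%:~R) ler_int => hk.
have [->|->] : k = 0 \/ k = 1 by lia.
- by left.
- by right.
Qed.

Lemma segment_sym (u v : 'rV[R]_2) : segment u v = segment v u.
Proof.
apply/seteqP; split => x [s hs ->]; exists (1 - s); rewrite ?subKr 1?addrC //;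
  by move: hs => /andP[? ?]; apply/andP; split; lra.
Qed.

Lemma segments_cross_sym (u v w z : 'rV[R]_2) :
  segments_cross u v w z -> segments_cross u v z w.
Proof.
case=> x [h1 h2 h3]; exists x; split=> //; first by rewrite segment_sym.
by case=> ? h; apply: h3; split=> //; case: h; [right|left].
Qed.

Lemma segment_latpt p q x : segment (latpt p) (latpt q) x ->
  exists2 s : R, 0 <= s <= 1 &
    [/\ x = vec2 (p.1%:~R + s * (q - p).1%:~R) (p.2%:~R + s * (q - p).2%:~R),
        s = 0 -> x = latpt p & s = 1 -> x = latpt q].
Proof.
case=> s hs ->; exists s => //; split.
- by rewrite !vec2Z vec2D /= !rmorphB /=; congr vec2; ring.
- by move=> ->; rewrite scale0r addr0 subr0 scale1r.
- by move=> ->; rewrite scale1r subrr scale0r add0r.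
Qed.

(** Cramer's rule with [c] the inverse of the determinant, so no division occurs: integer data and
    an integer [c] make [s] an integer. *)
Lemma cramer2 (c s d1 d2 f1 f2 x1 x2 : R) :
  c * (d1 * f2 - d2 * f1) = 1 -> s * d1 = x1 -> s * d2 = x2 ->
  s = c * (x1 * f2 - x2 * f1).
Proof. by move=> hc <- <-; rewrite -[LHS]mulr1 -hc; ring. Qed.

Lemma unit_int_inv (k : int) : `|k| = 1 -> (k%:~R : R) * k%:~R = 1.
Proof. by move=> hk; rewrite -intrM (_ : k * k = 1) //; nia. Qed.

(* Pairing [p + s d = a + r e] with [e] and with [d] shows that [s] and [r] are
   integers, so they are 0 or 1 and the common point is a common endpoint. *)
Lemma unimodular_segments_not_cross p q a b :
  `|cross2 (q - p) (b - a)| = 1 ->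
  ~ segments_cross (latpt p) (latpt q) (latpt a) (latpt b).
Proof.
move=> /unit_int_inv.
move=> hdet [x [/segment_latpt[s hs [xs s0 s1]] /segment_latpt[r hr [xr r0 r1]]]].
apply; move: (xr); rewrite {1}xs => /vec2_inj[E1 E2].
move: hdet E1 E2; move: (q - p) (b - a) => d e.
have kE : ((cross2 d e)%:~R : R) = d.1%:~R * e.2%:~R - d.2%:~R * e.1%:~R.
  by rewrite /cross2 !(intrM, intrB).
move: kE; move: (cross2 d e) => k kE hdet E1 E2.
have sE : s = (k * cross2 (a - p) e)%:~R.
  rewrite /cross2 /= !(intrB, intrM); have := hdet; rewrite {2}kE => hdet'.
  rewrite [LHS](cramer2 hdet' (erefl _) (erefl _)).
  rewrite (_ : s * _ = a.1%:~R + r * e.1%:~R - p.1%:~R); last by rewrite -E1 addrAC subrr add0r.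
  rewrite (_ : s * _ = a.2%:~R + r * e.2%:~R - p.2%:~R); last by rewrite -E2 addrAC subrr add0r.
  by ring.
have rE : r = (k * cross2 (a - p) d)%:~R.
  have hdet' : - k%:~R * (e.1%:~R * d.2%:~R - e.2%:~R * d.1%:~R) = 1 :> R.
    by rewrite -[RHS]hdet {3}kE; ring.
  rewrite /cross2 /= !(intrB, intrM) [LHS](cramer2 hdet' (erefl _) (erefl _)).
  rewrite (_ : r * _ = p.1%:~R + s * d.1%:~R - a.1%:~R); last by rewrite E1 addrAC subrr add0r.
  rewrite (_ : r * _ = p.2%:~R + s * d.2%:~R - a.2%:~R); last by rewrite E2 addrAC subrr add0r.
  by ring.
split.
- by case: (int_unit_interval hs sE); [move/s0; left | move/s1; right].
- by case: (int_unit_interval hr rE); [move/r0; left | move/r1; right].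
Qed.

(** Pairing [p + s d = a + r d] with [f] shows that [s - r] is an integer, hence 0, 1 or -1. The
    value 0 gives [p = a]; the other two put the common point at an end of both segments, which is
    not a crossing. *)
Lemma translated_segments_cross p q a b f : `|cross2 (q - p) f| = 1 ->
  b - a = q - p ->
  segments_cross (latpt p) (latpt q) (latpt a) (latpt b) -> p = a.
Proof.
move=> /unit_int_inv.
move=> hdet bq [x [/segment_latpt[s hs [xs s0 s1]] /segment_latpt[r hr [xr r0 r1]]]].
move=> ncommon; move: (xr); rewrite xs bq => /vec2_inj[E1 E2].
move: hdet E1 E2; move: (q - p) => d.
have kE : ((cross2 d f)%:~R : R) = d.1%:~R * f.2%:~R - d.2%:~R * f.1%:~R.
  by rewrite /cross2 !(intrM, intrB).
move: kE; move: (cross2 d f) => k kE hdet E1 E2.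
have srE : s - r = (k * cross2 (a - p) f)%:~R.
  rewrite /cross2 /= !(intrB, intrM); have := hdet; rewrite {2}kE => hdet'.
  rewrite [LHS](cramer2 hdet' (erefl _) (erefl _)).
  rewrite (_ : (s - r) * _ = a.1%:~R - p.1%:~R); last by lra.
  rewrite (_ : (s - r) * _ = a.2%:~R - p.2%:~R); last by lra.
  by ring.
move/andP: hs => [s_ge0 s_le1]; move/andP: hr => [r_ge0 r_le1].
set j := k * _ in srE.
have : (-1 <= j <= 1)%R.
  by rewrite -2!(ler_int R) -srE rmorphN /=; apply/andP; split; lra.
move=> j_bound; have [jE|[jE|jE]] : j = 0 \/ j = 1 \/ j = -1 by lia.
- move: srE; rewrite jE => /eqP; rewrite subr_eq0 => /eqP srE.
  move: E1 E2; rewrite srE => /addIr/eqP + /addIr/eqP.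
  by rewrite !eqr_int => /eqP E1 /eqP E2; case: (p) (a) E1 E2 => ? ? [? ?] /= -> ->.
- case: ncommon; move: srE; rewrite jE => srE.
  by split; [right; apply: s1|left; apply: r0]; lra.
- case: ncommon; move: srE; rewrite jE rmorphN => srE.
  by split; [left; apply: s0|right; apply: r1]; lra.
Qed.

Lemma parallel_segments_cross p q a b f : `|cross2 (q - p) f| = 1 ->
  b - a = q - p \/ b - a = p - q ->
  segments_cross (latpt p) (latpt q) (latpt a) (latpt b) ->
  (p = a /\ q = b) \/ (p = b /\ q = a).
Proof.
move=> hdet [E|E] hx.
- have pa := translated_segments_cross hdet E hx.
  by left; split=> //; move: E; rewrite pa => /addIr.
- have pb := translated_segments_cross hdet (a := b) (b := a) _ (segments_cross_sym hx).
  right; have {}pb : p = b by apply: pb; rewrite -[LHS]opprB E opprB.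
  by split=> //; apply: oppr_inj; move: E; rewrite pb => /addrI.
Qed.

(** * Crossing angles and slopes *)

(** The factors may be negative: a negative [r1 * r2] replaces the angle by its supplement, and the
    minimum is symmetric in the two. *)
Lemma crossing_angle_polar (u v w z : 'rV[R]_2) (r1 r2 a b : R) :
  r1 != 0 -> r2 != 0 ->
  v - u = r1 *: vec2 (cos a) (sin a) -> z - w = r2 *: vec2 (cos b) (sin b) ->
  `|a - b| <= pi ->
  crossing_angle u v w z = Num.min `|a - b| (pi - `|a - b|).
Proof.
move=> r1n0 r2n0; rewrite /crossing_angle => -> -> hab; rewrite /vec_angle /enorm.
rewrite !vec2Z !dot_vec2.
have normE r x : Num.sqrt (r * cos x * (r * cos x) + r * sin x * (r * sin x)) = `|r| :> R.
  by rewrite -sqrtr_sqr; congr Num.sqrt; rewrite -[RHS]mulr1 -(cos2Dsin2 x); ring.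
rewrite !normE.
have -> : r1 * cos a * (r2 * cos b) + r1 * sin a * (r2 * sin b)
    = r1 * r2 * cos `|a - b|.
  rewrite (_ : cos `|a - b| = cos (a - b)); last by case: ger0P => // _; rewrite cosN.
  by rewrite cosB; ring.
rewrite -normrM mulrAC.
have r12 : r1 * r2 != 0 by rewrite mulf_neq0.
have habI : `|a - b| \in `[0, pi] by rewrite in_itv /= normr_ge0.
have [r_gt|r_lt|r0] := ltrgt0P (r1 * r2).
- by rewrite divff // mul1r cosK.
- rewrite invrN mulrN divff // mulN1r acosN ?cosK //; last by rewrite cos_geN1 cos_le1.
  by rewrite subKr minC.
- by rewrite r0 eqxx in r12.
Qed.

Definition slope d : R := d.2%:~R / d.1%:~R.

Lemma latpt_polar d : 0 < d.1 -> exists2 r : R, r != 0 &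
  latpt d = r *: vec2 (cos (atan (slope d))) (sin (atan (slope d))).
Proof.
move=> d1; have d1R : 0 < (d.1%:~R : R) by rewrite ltr0z.
have c0 : 0 < cos (atan (slope d)).
  by apply: cos_gt0_pihalf; rewrite atan_gtNpi2 atan_ltpi2.
exists (d.1%:~R / cos (atan (slope d))); first by rewrite mulf_neq0 ?invr_neq0 ?gt_eqF.
have := atanK (slope d); rewrite /tan => tanE.
rewrite vec2Z; congr vec2; first by rewrite divfK ?gt_eqF.
by rewrite -mulrA [_^-1 * _]mulrC tanE /slope mulrC divfK ?gt_eqF.
Qed.

(** The difference of the slopes is the determinant over [d.1 * e.1], and the integer [e.1] is at
    least 1. *)
Lemma slope_dist d e : `|cross2 d e| = 1 -> 0 < d.1 -> 0 < e.1 ->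
  `|slope e - slope d| <= (d.1%:~R)^-1.
Proof.
move=> h d1 e1; have d1R : 0 < (d.1%:~R : R) by rewrite ltr0z.
have e1R : 1 <= (e.1%:~R : R) by rewrite ler1z.
have e0R : 0 < (e.1%:~R : R) by rewrite ltr0z.
have -> : slope e - slope d = (cross2 d e)%:~R / (d.1%:~R * e.1%:~R).
  rewrite /slope /cross2 intrB !intrM; field.
  by rewrite !gt_eqF.
rewrite normrM -intr_norm h mul1r ger0_norm; last by rewrite invr_ge0 ltW ?mulr_gt0.
by rewrite lef_pV2 ?posrE ?mulr_gt0 // ler_peMr // ltW.
Qed.

(** * Unimodular triples close to a given direction *)

Lemma cross2_triple d f (c c' : 'I_3) : cross2 d f = 1 -> c != c' ->
  `|cross2 (nth d [:: d; f; d + f] c) (nth d [:: d; f; d + f] c')| = 1.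
Proof.
case: d f => d1 d2 [f1 f2]; rewrite /cross2 /= => df.
by case: c c' => -[|[|[|//]]] ? [[|[|[|//]]] ?] //= _; lia.
Qed.

(* With [a/m] close to [x], [(m^2, m a + 1)] and [(m a - 1, a^2)] have
   determinant 1; a multiple of the first is added to the second to make its
   abscissa positive, and then all slopes differ by at most [1/m^2]. *)
Lemma unimodular_triple (x delta : R) : 0 < delta ->
  exists e : 'I_3 -> int * int, [/\ forall c, 0 < (e c).1,
    forall c c', c != c' -> `|cross2 (e c) (e c')| = 1 &
    forall c, `|slope (e c) - x| < delta].
Proof.
(* The slope of [d] is within [2 / m] of [x], and the other two slopes are within [1 / m] of that of
   [d]; hence the 3. *)
move=> delta0; pose m := (Num.bound (3 / delta)).+1.
have m1 : (1 <= m)%N by [].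
have mR1 : 1 <= (m%:R : R) by rewrite ler1n.
have mR0 : 0 < (m%:R : R) by rewrite ltr0n.
have hm : 3 / m%:R < delta.
  rewrite ltr_pdivrMr // mulrC -ltr_pdivrMr //.
  by rewrite (lt_le_trans (archi_boundP _)) ?divr_ge0 ?ler_nat ?ltW //.
pose a := Num.floor (m%:R * x).
have /andP[a1 a2] : a%:~R <= m%:R * x < (a + 1)%:~R by apply: floor_itv.
pose d : int * int := (m%:Z * m%:Z, m%:Z * a + 1).
(* The term [|a| * m^2] outweighs a negative [m a], and [2 * m^2] outweighs the -1. *)
pose j : int := `|a| + 2.
pose f : int * int := (m%:Z * a - 1 + j * (m%:Z * m%:Z), a * a + j * (m%:Z * a + 1)).
have df : cross2 d f = 1 by rewrite /cross2 /=; ring.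
have d1 : 0 < d.1 by rewrite /=; nia.
have f1 : 0 < f.1.
  rewrite /= /j.
  have h1 : `|a| * m%:Z <= `|a| * (m%:Z * m%:Z) by nia.
  have h2 : - (`|a| * m%:Z) <= m%:Z * a by nia.
  have h3 : 1 <= m%:Z * m%:Z by nia.
  rewrite mulrDl; lia.
pose e (c : 'I_3) := nth d [:: d; f; d + f] c.
have e1 c : 0 < (e c).1.
  by case: c => -[|[|[|//]]] ? //=; rewrite addr_gt0.
have ecross c c' : c != c' -> `|cross2 (e c) (e c')| = 1.
  exact: cross2_triple.
have dslope : `|slope d - x| <= 2 / m%:R.
  rewrite (_ : slope d - x = (a%:~R - m%:R * x) / m%:R + (m%:R * m%:R)^-1).
    apply: le_trans (ler_normD _ _) _.
    rewrite (_ : 2 / m%:R = m%:R^-1 + m%:R^-1); last by rewrite mulr_natl.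
    rewrite lerD //.
      have mV0 : 0 <= (m%:R : R)^-1 by rewrite invr_ge0 ltW.
      rewrite normrM [X in _ * X]ger0_norm // ler_piMl //.
      by move: a2; rewrite intrD ler_norml => ?; apply/andP; split; lra.
    rewrite ger0_norm; last by rewrite invr_ge0 ltW ?mulr_gt0.
    by rewrite lef_pV2 ?posrE ?mulr_gt0 // ler_peMr // ltW.
  rewrite /slope /= !(intrD, intrM) /=; field.
  by rewrite gt_eqF.
have dinv : (d.1%:~R)^-1 <= 1 / m%:R :> R.
  by rewrite div1r lef_pV2 ?posrE ?ltr0z // intrM ler_peMr // ltW.
exists e; split => // c.
apply: le_lt_trans hm; have [->|c0] := eqVneq c 0.
  by apply: le_trans dslope _; rewrite ler_pM2r ?invr_gt0 // ler_nat.
rewrite -(subrKA (slope d)); apply: le_trans (ler_normD _ _) _.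
rewrite (_ : 3 = 1 + 2) ?natrD // mulrDl lerD //; apply: le_trans dinv.
by apply: slope_dist => //; apply: (ecross 0); rewrite eq_sym.
Qed.

(** Continuity of [atan] at [tan theta] turns close slopes into close angles. *)
Lemma unimodular_triple_direction (theta eta : R) :
  - (pi / 2) < theta < pi / 2 -> 0 < eta ->
  exists e : 'I_3 -> int * int, [/\ forall c, 0 < (e c).1,
    forall c c', c != c' -> `|cross2 (e c) (e c')| = 1 &
    forall c, `|atan (slope (e c)) - theta| < eta].
Proof.
move=> htheta eta0; have /cvgrPdist_lt/(_ _ eta0)/nbhs_ballP := @continuous_atan R (tan theta).
move=> [delta /= delta0 hdelta].
have [e [e1 e2 e3]] := unimodular_triple (tan theta) delta0.
exists e; split=> // c; have := hdelta (slope (e c)).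
rewrite /ball /= distrC tanK ?in_itv // => /(_ (e3 c)).
by rewrite distrC.
Qed.

End LatticeSegments.

(** * The graph on the grid and its edges *)

Lemma eq_set2 (T : finType) (u v i j : T) :
  [set u; v]%SET = [set i; j]%SET -> (u = i /\ v = j) \/ (u = j /\ v = i).
Proof.
move=> /setP h; move: (h u) (h v) (h i) (h j); rewrite !inE !eqxx !orbT /=.
move=> /esym/orP[]/eqP -> /esym/orP[]/eqP ->; rewrite ?orbb; try by [left|right].
- by move=> _ /eqP ->; left.
- by move=> /eqP -> _; right.
Qed.

(** Vertices fill rows of length [L] from the bottom; those with index at least [L * L] continue
    above the square, so all [n] get distinct places. For [L = 0] the convention [i %% 0 = i] keeps
    the map injective. *)
Definition gridpt (L i : nat) : int * int := ((i %% L)%:Z, (i %/ L)%:Z).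

Lemma gridpt_inj L : injective (gridpt L).
Proof. by move=> i j [h1 h2]; rewrite (divn_eq i L) (divn_eq j L) h1 h2. Qed.

Lemma gridpt_index L x y : (x < L)%N -> gridpt L (y * L + x) = (x%:Z, y%:Z).
Proof.
move=> xL; rewrite /gridpt modnMDl modn_small // divnMDl ?divn_small ?addn0 //.
exact: leq_ltn_trans xL.
Qed.

(** Every vector starting in a suitable square of side [L - 2 * W] ends inside the grid, so each
    pair of a vector and a starting point gives an edge. Positive abscissas fix the orientation of
    an edge, so none is counted twice. *)
Lemma lattice_graph (R : realType) (n L W : nat) (K : finType) (w : K -> int * int) :
  (L * L <= n)%N -> injective w ->
  (forall k, 0 < (w k).1) -> (forall k, `|(w k).1| <= W%:Z /\ `|(w k).2| <= W%:Z) ->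
  exists G : geometric_graph R n,
  [/\ forall i, vpos G i = latpt R (gridpt L i),
      forall u v, [set u; v]%SET \in edges G -> exists k,
        gridpt L v - gridpt L u = w k \/ gridpt L v - gridpt L u = - w k &
      (#|K| * ((L - 2 * W) * (L - 2 * W)) <= #|edges G|)%N].
Proof.
move=> Ln w_inj w1 wW.
pose D := [set p : 'I_n * 'I_n | [exists k, gridpt L p.2 - gridpt L p.1 == w k]]%SET.
pose E := [set [set p.1; p.2]%SET | p in D]%SET.
have E2 e : e \in E -> #|e| = 2%N.
  case/imsetP => -[i j]; rewrite inE /= => /existsP[k /eqP hk] ->.
  rewrite cards2; case: eqP => // ij; move: (w1 k).
  by rewrite -hk ij subrr ltxx.
have pos_inj : injective (fun i : 'I_n => latpt R (gridpt L i)).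
  by move=> i j /latpt_inj/gridpt_inj/val_inj.
exists (GeometricGraph pos_inj E2); split=> //=.
  move=> u v /imsetP[[i j]]; rewrite inE /= => /existsP[k /eqP hk].
  case/eq_set2 => -[-> ->]; exists k; [left|right] => //.
  by rewrite -hk opprB.
set A := (L - 2 * W)%N.
have [A0|A0] := posnP A; first by rewrite A0 !muln0.
have bound_index x y : (x < L -> y < L -> y * L + x < n)%N by move=> *; nia.
have n0 : (0 < n)%N by move: A0; rewrite /A; nia.
pose idx x y : 'I_n := insubd (Ordinal n0) (y * L + x)%N.
have idxE x y : (x < L -> y < L -> gridpt L (idx x y) = (x%:Z, y%:Z))%N.
  by move=> xL yL; rewrite val_insubd bound_index // gridpt_index.
(* Abscissas only increase along a vector, but ordinates may drop by up to [W]; hence the upward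
   shift by [W], which also keeps [W + (w k).2] nonnegative under [absz]. *)
pose src (p : K * ('I_A * 'I_A)) := idx p.2.1 (p.2.2 + W)%N.
pose tgt (p : K * ('I_A * 'I_A)) :=
  idx (p.2.1 + `|(w p.1).1|)%N (p.2.2 + absz (W%:Z + (w p.1).2)%R)%N.
have srcE p : gridpt L (src p) = (p.2.1%:Z, (p.2.2 + W)%:Z).
  case: p => k [[x xA] [y yA]]; rewrite /src /= idxE //; move: xA yA; rewrite /A; lia.
have tgtE p : gridpt L (tgt p) - gridpt L (src p) = w p.1.
  rewrite srcE; case: p => k [[x xA] [y yA]]; rewrite /tgt /=.
  have [h1 h2] := wW k; have h3 := w1 k.
  rewrite idxE; [|by move: xA yA; rewrite /A; lia..].
  by case: (w k) h1 h2 h3 => a b /= h1 h2 h3; congr pair => /=; lia.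
have edge_inj : injective (fun p => [set src p; tgt p]%SET).
  move=> p q /eq_set2[[hs ht]|[hs ht]].
    have wpq : p.1 = q.1 by apply: w_inj; rewrite -!tgtE hs ht.
    have := srcE p; rewrite hs srcE; case: p q {hs ht} wpq => k [x y] [k' [x' y']] /= -> [hx hy].
    by congr (_, (_, _)); apply: val_inj => /=; lia.
  (* If the endpoints matched in reverse, two of the vectors would be opposite, though both have
     positive abscissa. *)
  have := w1 p.1; rewrite -tgtE hs ht -opprB tgtE /=.
  by rewrite oppr_gt0 ltNge ltW.
have -> : (#|K| * (A * A) = #|{: K * ('I_A * 'I_A)}|)%N by rewrite !card_prod card_ord.
rewrite -(card_codom edge_inj); apply: subset_leq_card; apply/fintype.subsetP => e /codomP[p ->].
apply/imsetP; exists (src p, tgt p) => //.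
by rewrite inE; apply/existsP; exists p.1; rewrite /= tgtE.
Qed.

Lemma nat_sqrt_exists n : exists L, (L * L <= n < L.+1 * L.+1)%N.
Proof.
elim: n => [|n [L hL]]; first by exists 0%N.
have [h|h] := ltnP n.+1 (L.+1 * L.+1); first by exists L; lia.
by exists L.+1; nia.
Qed.

(** * Superposition of [t] triangulations in separated directions *)

Section LatticeDirections.
Variables (R : realType) (t : nat).
Implicit Types (k l : 'I_t) (c : 'I_3).

(* The half-integer offset keeps the directions in the open right half-plane,
   where they have finite slopes. *)
Definition theta k : R := - (pi / 2) + (k%:R + 1 / 2) * (pi / t%:R).

Lemma theta_bounds k : - (pi / 2) < theta k < pi / 2.
Proof.
have t0 : (0 < t)%N by case: k => m; lia.
have tR : 0 < (t%:R : R) by rewrite ltr0n.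
have k1 : (k%:R : R) + 1 <= t%:R by rewrite natr1 ler_nat.
have k0 : 0 <= (k%:R : R) by [].
have pi0 := pi_gt0 R; have h0 : 0 < pi / t%:R :> R by rewrite divr_gt0.
have hE : t%:R * (pi / t%:R) = pi :> R by rewrite mulrC divfK ?gt_eqF.
rewrite /theta; apply/andP; split; last by nra.
by rewrite ltrDl mulr_gt0 // ltr_wpDl ?divr_gt0.
Qed.

(** The differences are multiples of [pi / t] by 1 to [t - 1]. The upper bound matters because
    angles close to [pi] also belong to nearly parallel lines. *)
Lemma theta_separated k l : k != l ->
  pi / t%:R <= `|theta k - theta l| <= pi - pi / t%:R.
Proof.
have t0 : (0 < t)%N by case: k => m; lia.
have tR : 0 < (t%:R : R) by rewrite ltr0n.
have pi0 := pi_gt0 R; have h0 : 0 < pi / t%:R :> R by rewrite divr_gt0.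
have hE : t%:R * (pi / t%:R) = pi :> R by rewrite mulrC divfK ?gt_eqF.
wlog lt_kl : k l / (k < l)%N.
  move=> H kl; have [h|h] := ltnP k l; first exact: H.
  by rewrite distrC H // 1?eq_sym // ltn_neqAle h eq_sym (inj_eq val_inj) kl.
move=> _; have lt : (l%:R : R) + 1 <= t%:R by rewrite natr1 ler_nat.
have kl : (k%:R : R) + 1 <= l%:R by rewrite natr1 ler_nat.
have k0 : 0 <= (k%:R : R) by [].
rewrite distrC ger0_norm /theta; last by nra.
by apply/andP; split; nra.
Qed.

Variables (eps : R) (w : 'I_t * 'I_3 -> int * int).
Hypothesis eps_le : eps <= pi / t%:R.
Hypothesis w1 : forall kc : _ * _, 0 < (w kc).1.
Hypothesis w_unimodular :
  forall k c c', c != c' -> `|cross2 (w (k, c)) (w (k, c'))| = 1.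
Hypothesis w_dir :
  forall k c, `|atan (slope R (w (k, c))) - theta k| < eps / 2.

Lemma angle_separated k c l c' : k != l ->
  pi / t%:R - eps <= `|atan (slope R (w (k, c))) - atan (slope R (w (l, c')))|
    <= pi - (pi / t%:R - eps).
Proof.
move=> /theta_separated; have := w_dir k c; have := w_dir l c'.
move: (atan _) (atan _) (theta k) (theta l) => a b x y.
rewrite !ltr_norml => /andP[? ?] /andP[? ?].
by case: (ger0P (x - y)) => ?; case: (ger0P (a - b)) => ? /andP[? ?];
  apply/andP; split; lra.
Qed.

(** A vector shared by two triangulations would be within [eps / 2] of two angles at least
    [pi / t >= eps] apart; within one triangulation equal vectors would have determinant 0. *)
Lemma direction_inj : injective w.
Proof.
move=> [k c] [l c'] wE; have [kl|kl] := eqVneq k l; last first.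
  have := theta_separated kl; have := w_dir k c; have := w_dir l c'; rewrite {}wE.
  move: (atan _) (theta k) (theta l) => a x y; rewrite !ltr_norml.
  move=> /andP[? ?] /andP[? ?]; have := eps_le.
  by case: (ger0P (x - y)) => ? ? /andP[? ?]; exfalso; lra.
have [->|cc] := eqVneq c c'; first by rewrite kl.
have := w_unimodular k cc; rewrite wE kl /cross2 mulrC subrr normr0.
by move/eqP; rewrite eq_sym oner_eq0.
Qed.

Lemma signed_polar kc d : d = w kc \/ d = - w kc -> exists2 r : R, r != 0 &
  latpt R d = r *: vec2 (cos (atan (slope R (w kc)))) (sin (atan (slope R (w kc)))).
Proof.
have [r r0 rE] := latpt_polar R (w1 kc).
case=> ->; first by exists r.
by exists (- r); rewrite ?oppr_eq0 // scaleNr -rE -sub0r -latptB (_ : latpt R 0 = 0)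
  ?sub0r //; apply/rowP => j; rewrite !mxE; case: ifP.
Qed.

(** Edges of different triangulations cross at a large angle. Within one triangulation, edges with
    different vectors have determinant 1 or -1 and do not cross, and parallel ones cross only if
    they coincide. *)
Lemma lattice_angle_crossing n L (G : geometric_graph R n) :
  (forall i, vpos G i = latpt R (gridpt L i)) ->
  (forall u v, [set u; v]%SET \in edges G -> exists kc,
     gridpt L v - gridpt L u = w kc \/ gridpt L v - gridpt L u = - w kc) ->
  angle_crossing (pi / t%:R - eps) G.
Proof.
move=> posE edgeE a b x y /edgeE[[k c] hab] /edgeE[[l c'] hxy] neq; rewrite !posE => hx.
have [kl|kl] := eqVneq k l; last first.
  have [r r0 rE] := signed_polar hab; have [r' r'0 r'E] := signed_polar hxy.
  rewrite (crossing_angle_polar r0 r'0 (a := atan (slope R (w (k, c))))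
    (b := atan (slope R (w (l, c'))))) ?latptB //.
    have /andP[h1 h2] := angle_separated c c' kl.
    by rewrite le_min h1 lerBrDl -lerBrDr.
  rewrite ler_norml.
  have := atan_gtNpi2 (slope R (w (k, c))); have := atan_ltpi2 (slope R (w (k, c))).
  have := atan_gtNpi2 (slope R (w (l, c'))); have := atan_ltpi2 (slope R (w (l, c'))).
  by move=> *; apply/andP; split; lra.
have cross2N d e : cross2 (- d) e = - cross2 d e by rewrite /cross2 /=; ring.
have cross2rN d e : cross2 d (- e) = - cross2 d e by rewrite /cross2 /=; ring.
subst l; case: neq; have [cc|cc] := eqVneq c c'; last first.
  case: (@unimodular_segments_not_cross R _ _ _ _ _ hx).
  by case: hab => ->; case: hxy => ->; rewrite ?(cross2N, cross2rN) ?normrN; apply: w_unimodular.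
subst c'.
(* Any other vector of the triple serves as the transversal [f] for the parallel case. *)
have [c' cc'] : exists c', c != c'.
  by have [->|c0] := eqVneq c 0; [exists 1|exists 0].
have hdet : `|cross2 (gridpt L b - gridpt L a) (w (k, c'))| = 1.
  by case: hab => ->; rewrite ?cross2N ?normrN w_unimodular.
have par : gridpt L y - gridpt L x = gridpt L b - gridpt L a \/
    gridpt L y - gridpt L x = gridpt L a - gridpt L b.
  by rewrite -(opprB (gridpt L b)); case: hab => ->; case: hxy => ->;
    rewrite ?opprK; [left|right|right|left].
have [[]|[]] := parallel_segments_cross hdet par hx.
- by move=> /gridpt_inj/val_inj -> /gridpt_inj/val_inj ->.
- by move=> /gridpt_inj/val_inj -> /gridpt_inj/val_inj ->; rewrite finset.setUC.
Qed.

End LatticeDirections.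

(** * Counting edges and choosing the parameters *)

(** Since [n <= L^2 + 2 L], the interior square misses at most [L * (4 * W + 2)] of the [n] points.
    Here [L <= n^(1/2)], and [(4 * W + 2) * eps <= n^(1/6)] for large [n], so the product is at most
    [n^(2/3) / eps]. *)
Lemma lattice_edge_count (R : realType) (eps : R) (t W : nat) : 0 < eps ->
  exists N : nat, forall n L m : nat, (N <= n)%N -> (L * L <= n < L.+1 * L.+1)%N ->
    (3 * t * ((L - 2 * W) * (L - 2 * W)) <= m)%N ->
    3 * t%:R * n%:R - 3 * (t%:R * n%:R `^ (2 / 3) / eps) <= m%:R :> R.
Proof.
move=> eps0; set c : R := (4 * W + 2)%:R * eps.
have c0 : 0 <= c by rewrite mulr_ge0 // ltW.
(* The sixth power yields [c <= n^(1/6)]; the successor makes [n] positive, as adding exponents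
   requires. *)
exists (Num.bound (c ^+ 6)).+1 => n L m Nn /andP[L1 L2] hm.
have n_c : c `^ 6 <= n%:R.
  rewrite powR_mulrn // ltW // (lt_le_trans (archi_boundP _)) ?exprn_ge0 //.
  by rewrite ler_nat ltnW.
have n0 : 0 <= n%:R :> R by [].
have h6 : c <= n%:R `^ (1 / 6).
  have -> : c = (c `^ 6) `^ (1 / 6) by rewrite -powRrM mul1r divff ?powRr1 ?pnatr_eq0.
  by apply: ge0_ler_powR; rewrite ?nnegrE ?powR_ge0 ?divr_ge0.
have h2 : L%:R <= n%:R `^ (1 / 2) :> R.
  have -> : L%:R = (L%:R `^ 2) `^ (1 / 2) :> R by rewrite -powRrM mul1r divff ?powRr1 ?pnatr_eq0.
  apply: ge0_ler_powR; rewrite ?nnegrE ?powR_ge0 ?divr_ge0 //.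
  by rewrite powR_mulrn // -natrX ler_nat expnS expn1.
have h23 : n%:R `^ (2 / 3) = n%:R `^ (1 / 2) * n%:R `^ (1 / 6) :> R.
  rewrite -powRD; last by rewrite (_ : n%:R != 0 :> R) ?implybT // pnatr_eq0 -lt0n; lia.
  by congr powR; field.
have hL : (L * (4 * W + 2))%:R <= n%:R `^ (2 / 3) / eps :> R.
  by rewrite ler_pdivlMr // natrM -mulrA h23 ler_pM.
have hmn : (3 * t * n <= m + 3 * t * (L * (4 * W + 2)))%N.
  have : (n <= (L - 2 * W) * (L - 2 * W) + L * (4 * W + 2))%N by nia.
  by move=> /(leq_mul (leqnn (3 * t))); rewrite mulnDr => /leq_trans; apply; rewrite leq_add2r.
move: hmn; rewrite -(ler_nat R) !(natrD, natrM) => hmn.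
rewrite lerBlDr (le_trans hmn) // lerD2l -!mulrA ler_pM2l // ler_wpM2l //.
by move: hL; rewrite !(natrD, natrM).
Qed.

Theorem theorem4 (R : realType) :
  exists2 C : R, 0 < C &
    forall (eps : R) (t : nat), 0 < eps -> (2 <= t)%N ->
    exists N : nat, forall n : nat, (N <= n)%N ->
    exists G : geometric_graph R n,
      angle_crossing (pi / t%:R - eps) G /\
      3 * t%:R * n%:R - C * (t%:R * n%:R `^ (2 / 3) / eps)
        <= (#|edges G|)%:R.
Proof.
exists 3 => // eps t eps0 t2.
(* The cap at [pi / t] keeps the [t] families of vectors disjoint; a smaller tolerance only
   strengthens the angle bound, and the edge count keeps the original [eps]. *)
pose eps' : R := Num.min eps (pi / t%:R).
have eps'0 : 0 < eps'.
  by rewrite lt_min eps0 divr_gt0 ?pi_gt0 // ltr0n ltnW.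
have /fin_all_exists[e he] (k : 'I_t) := unimodular_triple_direction (theta_bounds R k)
  (divr_gt0 eps'0 (ltr0Sn R 1)).
pose w (kc : 'I_t * 'I_3) := e kc.1 kc.2.
have w1 kc : 0 < (w kc).1 by case: (he kc.1) => h _ _; apply: h.
have w_uni k c c' : c != c' -> `|cross2 (w (k, c)) (w (k, c'))| = 1.
  by case: (he k) => _ h _; apply: h.
have w_dir k c : `|atan (slope R (w (k, c))) - theta R k| < eps' / 2.
  by case: (he k) => _ _; apply.
have eps'_le : eps' <= pi / t%:R by rewrite ge_min lexx orbT.
have w_inj := direction_inj eps'_le w_uni w_dir.
(* [W] depends on the chosen vectors only, so the threshold [N] can be fixed before [n]. *)
pose W := (\max_kc maxn (absz (w kc).1) (absz (w kc).2))%N.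
have wW kc : `|(w kc).1| <= W%:Z /\ `|(w kc).2| <= W%:Z.
  have := @leq_bigmax _ (fun kc => maxn (absz (w kc).1) (absz (w kc).2)) kc.
  by rewrite -/W; lia.
have [N hN] := lattice_edge_count t W eps0.
exists N => n Nn; have [L hL] := nat_sqrt_exists n.
have /andP[Ln _] := hL.
have [G [posE edgeE cardE]] := lattice_graph R Ln w_inj w1 wW.
exists G; split; last first.
  by apply: hN hL _ => //; rewrite card_prod !card_ord mulnC [(t * 3)%N]mulnC mulnC in cardE.
move=> u v x y h1 h2 h3 h4.
apply: le_trans (lattice_angle_crossing w1 w_uni w_dir posE edgeE h1 h2 h3 h4).
by rewrite lerD2l lerN2 /eps' ge_min lexx.
Qed.
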